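(* Let $0<q<1$ be real, let $k\ge 1$ and $t\ge 1$ be integers and let $n\ge 0$ be an integer. Then $$|\mathrm{T}_{n,k}^1,\omega|=[1]_{n,k}=\frac{\Gamma_{q,k}(1+nk)}{\Gamma_{q,k}(1)}=\frac{1}{\Gamma_{q,k}(1)}\int_0^{\frac{[k]_q^{1/k}}{(1-q^k)^{1/k}}}x^{nk}E_{q^k}^{-\frac{q^kx^k}{[k]_q}}\,d_qx ,$$ and more generally $$|\mathrm{T}_{n,k}^t,\omega|=[t]_{n,k}=\frac{\Gamma_{q,k}(t+nk)}{\Gamma_{q,k}(t)}=\frac{1}{\Gamma_{q,k}(t)}\int_0^{\frac{[k]_q^{1/k}}{(1-q^k)^{1/k}}}x^{t+nk-1}E_{q^k}^{-\frac{q^kx^k}{[k]_q}}\,d_qx .$$ Here the polynomials $|\mathrm{T}_{n,k}^t,\omega|\in\mathbb{N}[q]$ are evaluated at the given real number $q$.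
   Context: Notation. For $0<p<1$ and real $a$, $[a]_p=\frac{1-p^a}{1-p}$ and $[n]_p!=\prod_{j=1}^n[j]_p$ (empty products equal $1$). $[t]_{n,k}=\prod_{j=0}^{n-1}[t+jk]_q$. The $p$-exponential is $E_p^{x}=\sum_{n=0}^\infty p^{n(n-1)/2}\frac{x^n}{[n]_p!}$; thus $E_{q^k}^{-\frac{q^kx^k}{[k]_q}}=\sum_{n=0}^\infty\frac{(-1)^nq^{kn(n+1)/2}x^{kn}}{[k]_q^n[n]_{q^k}!}$. Jackson integral. For $b\ge 0$, $\int_0^b f(x)\,d_qx=(1-q)b\sum_{n=0}^\infty q^nf(q^nb)$. $q,k$-gamma function. Put $(1+x)_{q^k}^\infty=\prod_{j=0}^\infty(1+q^{jk}x)$ and, for real $a$, $(1+x)_{q^k}^{a}=\frac{(1+x)_{q^k}^\infty}{(1+q^{ka}x)_{q^k}^\infty}$. For $t>0$, $$\Gamma_{q,k}(t)=\frac{(1-q^k)_{q^k}^{\frac tk-1}}{(1-q)^{\frac tk-1}}=\frac{(1-q)^{1-\frac tk}(1-q^k)_{q^k}^\infty}{(1-q^t)_{q^k}^\infty}.$$ $q$-weighted sets. For a finite set $x$ and a map $\omega:x\to\mathbb{N}[q]$, $|x,\omega|=\sum_{i\in x}\omega(i)$. Trees. $\mathrm{T}_{n,k}^t$ is the set of isomorphism classes of planar rooted trees $T$ (edges are oriented toward the root, and the incoming edges at each vertex are linearly ordered; isomorphisms preserve the root, these orders, and the labels of internal vertices) such that: (1) the set of internal vertices of $T$, i.e. vertices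 with one outgoing edge and at least one incoming edge, is $\{1,2,\dots,n\}$; (2) $T$ has a unique vertex with no outgoing edge, called the root; the vertices with no incoming edges are called leaves, and they form the set $L(T)$; (3) each internal vertex has valence $k+2$ (one outgoing and $k+1$ incoming edges); (4) the root has valence $t$ (i.e. $t$ incoming edges); (5) if the internal vertex $i$ lies on the path from the internal vertex $j\neq i$ to the root, then $i<j$. The leaves are unlabelled, but the planar structure gives a natural linear (left to right) order on $L(T)$, so leaves are numbered $1,\dots,|L(T)|$. Weight. Let $r_t$ be the rooted tree with $t$ leaves and no internal vertices. For $1\le i\le n$ let $c_i$ be the rooted tree with unique internal vertex $i$ and $k+1$ leaves. If $T$ is a planar rooted tree and $1\le l\le |L(T)|$, then $T\circ_l c_i$ is the planar rooted tree obtained by gluing the root of $c_i$ to the leaf numbered $l$ of $T$ to form a new edge; that is, leaf $l$ of $T$ is replaced by the internal vertex $i$, which has $k+1$ leaves attached. Each $T\in\mathrm{T}_{n,k}^t$ can be written in a unique way as $T=(\dots((r_t\circ_{l_1}c_1)\circ_{l_2}c_2)\dots)\circ_{l_n}c_n$, and its weight is $\omega(T)=\prod_{i=1}^{n}q^{l_i-1}\in\mathbb{N}[q]$. *)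

(* Defs.v *)
(* MathComp / MathComp-Analysis *)
From HB Require Import structures.
From mathcomp Require Import all_boot all_order all_algebra.
From mathcomp Require Import all_classical all_reals all_analysis.

Set Implicit Arguments.
Unset Strict Implicit.
Unset Printing Implicit Defensive.

Import Order.TTheory GRing.Theory Num.Theory.
Import numFieldNormedType.Exports.

Local Open Scope classical_set_scope.
Local Open Scope ring_scope.

(** ** q-analogues *)

Section QAnalogues.
Context {R : realType}.
Implicit Types (p q a x t b : R) (k n : nat).

Definition qbracket p a : R := (1 - p `^ a) / (1 - p).

Definition qfact p n : R := \prod_(1 <= j < n.+1) qbracket p j%:R.

(* [t]_{n,k} *)
Definition qpochhammer q t n k : R :=
  \prod_(0 <= j < n) qbracket q (t + (j * k)%:R).

(* E_p^x *)
Definition qexp p x : R :=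
  \big[+%R/0]_(0 <= n <oo) (p ^+ ((n * n.-1) %/ 2) * (x ^+ n / qfact p n)).

(* (1 + x)_{q^k}^oo and (1 + x)_{q^k}^a; the argument is x, not 1 + x *)
Definition qprod_infty q k x : R :=
  \big[*%R/1]_(0 <= j <oo) (1 + q ^+ (j * k) * x).

Definition qprod_pow q k x a : R :=
  qprod_infty q k x / qprod_infty q k (q `^ (k%:R * a) * x).

(* Gamma_{q,k}(t) *)
Definition qkGamma q k t : R :=
  qprod_pow q k (- q ^+ k) (t / k%:R - 1) / (1 - q) `^ (t / k%:R - 1).

(* int_0^b f(x) d_q x *)
Definition jackson q b (f : R -> R) : R :=
  (1 - q) * b * \big[+%R/0]_(0 <= n <oo) (q ^+ n * f (q ^+ n * b)).

End QAnalogues.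

(** ** Planar rooted trees *)

(* A planar tree hanging from an edge: either a leaf, or an internal vertex
   with its label and the left-to-right list of the subtrees above it.  A planar
   rooted tree is the list of the subtrees hanging from its (unlabelled) root.
   Isomorphism classes of planar rooted trees with labelled internal vertices
   are the elements of [seq ptree], and isomorphism is equality. *)
Inductive ptree : Type := Leaf | Node of nat & seq ptree.

Fixpoint ptree_encode (T : ptree) : GenTree.tree unit :=
  match T with
  | Leaf => GenTree.Leaf tt
  | Node i s => GenTree.Node i (map ptree_encode s)
  end.

Fixpoint ptree_decode (T : GenTree.tree unit) : ptree :=
  match T with
  | GenTree.Leaf _ => Leaf
  | GenTree.Node i s => Node i (map ptree_decode s)
  end.

Lemma ptree_encodeK : cancel ptree_encode ptree_decode.
Proof.
rewrite /cancel; fix IH 1; case=> [|i s] /=; first reflexivity.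
congr Node.
by elim: s => //= T s ->; rewrite IH.
Qed.

HB.instance Definition _ := Countable.copy ptree (can_type ptree_encodeK).

Fixpoint nleaves (T : ptree) : nat :=
  if T is Node _ s then sumn (map nleaves s) else 1.

Fixpoint labels (T : ptree) : seq nat :=
  if T is Node i s then i :: flatten (map labels s) else [::].

Fixpoint arity (m : nat) (T : ptree) : bool :=
  if T is Node _ s then (size s == m) && all (arity m) s else true.

(* the label of each internal vertex is smaller than those of all the internal
   vertices whose path to the root passes through it *)
Fixpoint increasing (T : ptree) : bool :=
  if T is Node i s then
    all (fun j => (i < j)%N) (flatten (map labels s)) && all increasing s
  else true.

Definition rleaves (F : seq ptree) : nat := sumn (map nleaves F).

Definition rlabels (F : seq ptree) : seq nat := flatten (map labels F).

(* T_{n,k}^t *)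
Definition trees (n k t : nat) : set (seq ptree) :=
  [set F | [/\ perm_eq (rlabels F) (iota 1 n),
               all (arity k.+1) F,
               size F = t &
               all increasing F]].

(** ** Grafting and weights *)

(* [graft_seq g l s] passes to each subtree of [s] the position of leaf number
   [l] of [s] relative to that subtree.  Leaves are numbered from 1, so a
   relative position that is 0 (by truncated subtraction) or larger than the
   number of leaves of the subtree leaves that subtree unchanged. *)
Definition graft_seq (g : nat -> ptree -> ptree) :=
  fix loop (l : nat) (s : seq ptree) : seq ptree :=
    if s is T :: s' then g l T :: loop (l - nleaves T)%N s' else [::].

Fixpoint graft (c : ptree) (l : nat) (T : ptree) : ptree :=
  match T with
  | Leaf => if l == 1%N then c else Leaf
  | Node i s => Node i (graft_seq (graft c) l s)
  end.

(* the internal vertex of c_i with its k + 1 leaves *)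
Definition corolla (k i : nat) : ptree := Node i (nseq k.+1 Leaf).

(* T o_l c_i *)
Definition rgraft (k : nat) (F : seq ptree) (l i : nat) : seq ptree :=
  graft_seq (graft (corolla k i)) l F.

(* [composes k t [:: l_1; ...; l_n] T] means
   T = (...((r_t o_{l_1} c_1) o_{l_2} c_2)...) o_{l_n} c_n, where each l_i
   is the number of a leaf of the tree on which c_i is grafted. *)
Inductive composes (k t : nat) : seq nat -> seq ptree -> Prop :=
| composes_nil : composes k t [::] (nseq t Leaf)
| composes_rcons ls l F :
    composes k t ls F -> (1 <= l <= rleaves F)%N ->
    composes k t (rcons ls l) (rgraft k F l (size ls).+1).

(* The sequence (l_1, ..., l_n); it exists and is unique for T in T_{n,k}^t.
   The default value [::] is only used outside of these sets. *)
Definition decomposition (k t : nat) (F : seq ptree) : seq nat :=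
  xget [::] [set ls | composes k t ls F].

(* omega(T), a polynomial in the variable q = 'X with natural coefficients *)
Definition weight (k t : nat) (F : seq ptree) : {poly nat} :=
  \prod_(l <- decomposition k t F) 'X^(l.-1).

(* |x, omega| for a finite set x *)
Definition qcard {T : choiceType} (A : set T) (w : T -> {poly nat}) :
  {poly nat} := \sum_(i \in A) w i.

Definition evalN {R : realType} (P : {poly nat}) (q : R) : R :=
  (map_poly (fun m : nat => m%:R) P).[q].

(* Main.v *)
(* Along a tree of T_{n,k}^t labels increase, so the vertex n carries only
   leaves; cutting it off shows that T_{n,k}^t is in bijection with the
   sequences (l_1, ..., l_n) such that 1 <= l_i <= t + (i - 1) k, whence the
   product formula.  Put p = q^k, (z; p)_n = prod_(j < n) (1 - p^j z) and
   S z = sum_n z^n / (p; p)_n.  From (1 - z) S z = S (p z) and the similar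
   equation F z = (1 - z) F (p z) for the q-exponential series F, letting
   p^n z -> 0 gives Euler's identities F z = (z; p)_oo = 1 / S z.  Hence
   Gamma_{q,k}(s) = (1 - q)^(1 - s/k) S(q^s) / S(p), and the m-th term of the
   Jackson integral is, up to a constant, (q^s)^m / (p; p)_m, so the integral
   sums to a multiple of S(q^s). *)
Require Import Defs.
From mathcomp Require Import all_boot all_order all_algebra.
From mathcomp Require Import all_classical all_reals all_analysis.
From mathcomp Require Import ring zify.
Import Order.TTheory GRing.Theory Num.Theory.
Import numFieldNormedType.Exports.
Local Open Scope ring_scope.

(** * Grafting and pruning *)

(** [ptree] is nested in [seq], so its generated induction principle gives no hypothesis on
    subtrees. Here a leading [Node i s1] is opened into its forest [s1], so that later statements
    can speak of forests alone. *)
Lemma forest_ind (Q : seq ptree -> Prop) :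
  Q [::] -> (forall s, Q s -> Q (Leaf :: s)) ->
  (forall i s1 s2, Q s1 -> Q s2 -> Q (Node i s1 :: s2)) -> forall s, Q s.
Proof.
move=> Q0 QL QN.
have consT : forall T s, Q s -> Q (T :: s).
  fix IH 1 => -[|i s1] s Qs; first exact: QL.
  apply: QN => //; elim: s1 => [//|T s1 Qs1]; exact: IH.
by elim=> // T s Qs; apply: consT.
Qed.

Section Grafting.
#[local] Set Implicit Arguments.
#[local] Unset Strict Implicit.
Context (k : nat).
Implicit Types (F : seq ptree) (i j l : nat).

Lemma rgraft_Leaf i l F :
  rgraft k (Leaf :: F) l i =
    (if l == 1%N then corolla k i else Leaf) :: rgraft k F (l - 1) i.
Proof. by []. Qed.

Lemma rgraft_Node i j l F1 F2 :
  rgraft k (Node j F1 :: F2) l i =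
    Node j (rgraft k F1 l i) :: rgraft k F2 (l - rleaves F1) i.
Proof. by []. Qed.

Lemma rlabels_Node j F1 F2 :
  rlabels (Node j F1 :: F2) = j :: rlabels F1 ++ rlabels F2.
Proof. by []. Qed.

Lemma rleaves_Leaf F : rleaves (Leaf :: F) = (rleaves F).+1.
Proof. by []. Qed.

Lemma rleaves_Node j F1 F2 :
  rleaves (Node j F1 :: F2) = (rleaves F1 + rleaves F2)%N.
Proof. by []. Qed.

Lemma rlabels_nseq m : rlabels (nseq m Leaf) = [::].
Proof. by elim: m. Qed.

Lemma rleaves_nseq m : rleaves (nseq m Leaf) = m.
Proof. by rewrite /rleaves map_nseq sumn_nseq mul1n. Qed.

Lemma rlabels_eq0 F : rlabels F = [::] -> F = nseq (size F) Leaf.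
Proof. by elim/forest_ind: F => //= F IH /IH <-. Qed.

(** Leaves are numbered from 1; position 0 arises by truncated subtraction when the chosen leaf lies
    further left. *)
Lemma rgraft0 F i : rgraft k F 0 i = F.
Proof.
elim/forest_ind: F => // [F IH|j F1 F2 IH1 IH2]; first by rewrite rgraft_Leaf IH.
by rewrite rgraft_Node IH1 sub0n IH2.
Qed.

Lemma rgraft_oversize F l i : (rleaves F < l)%N -> rgraft k F l i = F.
Proof.
elim/forest_ind: F l => // [F IH|j F1 F2 IH1 IH2] l.
  rewrite rgraft_Leaf rleaves_Leaf => lF.
  by rewrite IH; [case: eqP => //; lia|lia].
by rewrite rgraft_Node rleaves_Node => lF; rewrite IH1 ?IH2 //; lia.
Qed.

Lemma perm_rlabels_rgraft F l i : (1 <= l <= rleaves F)%N ->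
  perm_eq (rlabels (rgraft k F l i)) (i :: rlabels F).
Proof.
elim/forest_ind: F l => [|F IH|j F1 F2 IH1 IH2] l.
    by rewrite /rleaves /=; lia.
  rewrite rgraft_Leaf rleaves_Leaf; case: eqP => [-> _|l1 lF].
    by rewrite subnn rgraft0 /corolla rlabels_Node rlabels_nseq.
  by apply: IH; lia.
rewrite rgraft_Node !rlabels_Node rleaves_Node => lF.
(* Exactly one of [F1] and [F2] contains leaf [l]; the other receives a position out of range and is
   unchanged. *)
have [lF1|lF1] := leqP l (rleaves F1).
  have -> : (l - rleaves F1 = 0)%N by lia.
  have /permP e : perm_eq (rlabels (rgraft k F1 l i)) (i :: rlabels F1).
    by apply: IH1; lia.
  by rewrite rgraft0; apply/permP => a; rewrite /= !count_cat e /=; lia.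
rewrite [rgraft k F1 _ _]rgraft_oversize //.
have /permP e : perm_eq (rlabels (rgraft k F2 (l - rleaves F1) i))
    (i :: rlabels F2) by apply: IH2; lia.
by apply/permP => a; rewrite /= !count_cat e /=; lia.
Qed.

Lemma size_rgraft F l i : size (rgraft k F l i) = size F.
Proof. by rewrite /rgraft; elim: F l => //= T F IH l; rewrite IH. Qed.

Lemma arity_rgraft F l i :
  all (arity k.+1) F -> all (arity k.+1) (rgraft k F l i).
Proof.
elim/forest_ind: F l => // [F IH|j F1 F2 IH1 IH2] l.
  rewrite rgraft_Leaf /= => /IH ->; rewrite andbT.
  case: ifP => // _.
  rewrite -[arity _ _]/((size (nseq k.+1 Leaf) == k.+1) &&
    all (arity k.+1) (nseq k.+1 Leaf)).
  by rewrite size_nseq eqxx all_nseq orbT.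
rewrite rgraft_Node /= -andbA => /and3P[F1k aF1 aF2].
by rewrite size_rgraft F1k IH1 ?IH2.
Qed.

Lemma all_rlabels_rgraft (a : pred nat) F l i :
  all a (rlabels F) -> a i -> all a (rlabels (rgraft k F l i)).
Proof.
move=> aF ai.
have [l0|l0] := posnP l; first by rewrite l0 rgraft0.
have [lF|lF] := leqP l (rleaves F); last by rewrite rgraft_oversize.
by rewrite (perm_all _ (@perm_rlabels_rgraft F l i _)) ?l0 //= ai.
Qed.

(** The new label exceeds those of its ancestors, and only leaves sit above the new vertex. *)
Lemma increasing_rgraft F l i : all (fun j => (j < i)%N) (rlabels F) ->
  all increasing F -> all increasing (rgraft k F l i).
Proof.
elim/forest_ind: F l => // [F IH|j F1 F2 IH1 IH2] l.
  rewrite rgraft_Leaf /= => Fi /(IH _ Fi) ->; rewrite andbT.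
  case: ifP => //= _.
  by rewrite -[flatten _]/(rlabels (nseq k Leaf)) rlabels_nseq /= all_nseq orbT.
rewrite rgraft_Node rlabels_Node /= all_cat => /and3P[ji F1i F2i].
move=> /andP[/andP[jF1 incF1] incF2].
by rewrite -!/(rlabels _) all_rlabels_rgraft // IH1 ?IH2.
Qed.

(** Undoes a graft: vertex [i] becomes a leaf again and everything above it is discarded. *)
Fixpoint prune i (T : ptree) : ptree :=
  if T is Node j s then
    if j == i then Leaf else Node j (map (prune i) s)
  else Leaf.

Definition rprune i F := map (prune i) F.

Lemma rprune_Leaf i F : rprune i (Leaf :: F) = Leaf :: rprune i F.
Proof. by []. Qed.

Lemma rprune_Node i j F1 F2 :
  rprune i (Node j F1 :: F2) =
    (if j == i then Leaf else Node j (rprune i F1)) :: rprune i F2.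
Proof. by []. Qed.

Lemma rprune_id i F : i \notin rlabels F -> rprune i F = F.
Proof.
elim/forest_ind: F => // [F IH iF|j F1 F2 IH1 IH2].
  by rewrite /= IH.
rewrite rprune_Node rlabels_Node inE mem_cat eq_sym !negb_or => /and3P[/negbTE ->].
by move=> /IH1 -> /IH2 ->.
Qed.

(** Freshness of [i] makes the grafted vertex the only one that pruning can cut. If [l] is out of
    range, nothing is grafted and nothing is cut. *)
Lemma rgraftK i F l : i \notin rlabels F -> rprune i (rgraft k F l i) = F.
Proof.
elim/forest_ind: F l => // [F IH|j F1 F2 IH1 IH2] l.
  rewrite rgraft_Leaf /= => iF; rewrite -/(rprune _ _) IH //.
  by case: ifP => //= _; rewrite eqxx.
rewrite rgraft_Node rprune_Node rlabels_Node inE mem_cat eq_sym !negb_or.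
by move=> /and3P[/negbTE -> iF1 iF2]; rewrite IH1 ?IH2.
Qed.

Lemma rgraft_neq F l i : (1 <= l <= rleaves F)%N -> rgraft k F l i <> F.
Proof.
move=> /(@perm_rlabels_rgraft F l i)/perm_size /= + FF.
by rewrite FF => /n_Sn.
Qed.

Lemma rgraft_inj F l l' i :
  (1 <= l <= rleaves F)%N -> (1 <= l' <= rleaves F)%N ->
  rgraft k F l i = rgraft k F l' i -> l = l'.
Proof.
elim/forest_ind: F l l' => [|F IH|j F1 F2 IH1 IH2] l l'.
    by rewrite /rleaves /=; lia.
  rewrite !rgraft_Leaf rleaves_Leaf => lF l'F [].
  case: eqP => l1; case: eqP => l'1 //; first by rewrite l1 l'1.
  by move=> _ /IH; lia.
rewrite !rgraft_Node rleaves_Node => lF l'F [] e1 e2.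
(* In the two mixed cases one graft changes [F1] and the other does not, which [rgraft_neq]
   excludes. *)
have [lF1|lF1] := leqP l (rleaves F1); have [l'F1|l'F1] := leqP l' (rleaves F1).
- by apply: IH1 e1; lia.
- by move: e1; rewrite (@rgraft_oversize F1 l') // => /rgraft_neq []; lia.
- by move: e1; rewrite (@rgraft_oversize F1 l) // => /esym/rgraft_neq []; lia.
- by move/IH2: e2; lia.
Qed.

Lemma rprune_arity i F : all (arity k.+1) F -> all (arity k.+1) (rprune i F).
Proof.
elim/forest_ind: F => // j F1 F2 IH1 IH2.
rewrite rprune_Node /= -andbA => /and3P[F1k /IH1 aF1 /IH2 ->].
by case: ifP => //= _; rewrite size_map F1k aF1.
Qed.

Lemma all_rlabels_rprune (a : pred nat) i F :
  all a (rlabels F) -> all a (rlabels (rprune i F)).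
Proof.
elim/forest_ind: F => // j F1 F2 IH1 IH2.
rewrite rprune_Node rlabels_Node /= all_cat => /and3P[aj /IH1 aF1 /IH2 aF2].
by case: ifP => //= _; rewrite all_cat aj aF2 andbT.
Qed.

Lemma increasing_rprune i F : all increasing F -> all increasing (rprune i F).
Proof.
elim/forest_ind: F => // j F1 F2 IH1 IH2.
rewrite rprune_Node /= => /andP[/andP[jF1 /IH1 iF1] /IH2 ->].
by case: ifP => //= _; rewrite iF1 !andbT; apply: all_rlabels_rprune.
Qed.

(* The children of the vertex with the largest label are leaves, so that vertex
   together with its children is a corolla that was grafted last. *)
Lemma rprune_rgraft i F : all (fun j => (j <= i)%N) (rlabels F) ->
    uniq (rlabels F) -> i \in rlabels F ->
    all (arity k.+1) F -> all increasing F ->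
  exists2 l, (1 <= l <= rleaves (rprune i F))%N & rgraft k (rprune i F) l i = F.
Proof.
elim/forest_ind: F => // [F IH|j F1 F2 IH1 IH2].
  move=> /IH{}IH /IH{}IH /IH{}IH /IH{}IH /IH[l lF e].
  exists l.+1; first by rewrite rprune_Leaf rleaves_Leaf; lia.
  by rewrite rprune_Leaf rgraft_Leaf subn1 e; case: eqP => //; lia.
move=> aF uF iF /andP[/andP[/eqP sF1 aF1] aF2] /andP[/andP[jF1 incF1] incF2].
rewrite rlabels_Node /= all_cat cat_uniq in aF uF.
case/and3P: aF uF => ji F1i F2i /andP[jF /and3P[uF1 dF uF2]].
move: jF; rewrite mem_cat negb_or => /andP[jnF1 jnF2].
have [jei|jni] := eqVneq j i.
  (* A label [h] above vertex [i] would satisfy i < h <= i. *)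
  have F1nil : rlabels F1 = [::].
    case E : (rlabels F1) => [//|h r].
    have hF1 : h \in rlabels F1 by rewrite E mem_head.
    by have := leq_trans (allP jF1 h hF1) (allP F1i h hF1); rewrite jei ltnn.
  exists 1%N; rewrite rprune_Node jei eqxx ?rleaves_Leaf //.
  rewrite rgraft_Leaf eqxx subnn rgraft0 rprune_id -?jei //.
  by rewrite /corolla -sF1 -rlabels_eq0.
have {}iF : (i \in rlabels F1) || (i \in rlabels F2).
  by move: iF; rewrite inE eq_sym (negbTE jni) mem_cat.
rewrite rprune_Node (negbTE jni) rleaves_Node.
case/orP: iF => iF.
  have iF2 : i \notin rlabels F2.
    by apply: contra dF => iF2; apply/hasP; exists i.
  have [l lF e] := IH1 F1i uF1 iF aF1 incF1.
  exists l; first by clear -lF; lia.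
  rewrite rgraft_Node e rprune_id //.
  have -> : (l - rleaves (rprune i F1) = 0)%N by clear -lF; lia.
  by rewrite rgraft0.
have iF1 : i \notin rlabels F1.
  by apply: contra dF => iF1; apply/hasP; exists i.
have [l lF e] := IH2 F2i uF2 iF aF2 incF2.
(* The leaves of [F1] are numbered first, hence the shift. *)
rewrite (rprune_id iF1); exists (rleaves F1 + l)%N; first by clear -lF; lia.
by rewrite rgraft_Node addKn e rgraft_oversize //; clear -lF; lia.
Qed.

End Grafting.

(** * Enumeration of the trees by their grafting positions *)

Section Enumeration.
#[local] Set Implicit Arguments.
#[local] Unset Strict Implicit.
Context (k t : nat).

(** All results of grafting c_1, ..., c_n in this order. The bound on [l] is the number of leaves
    after m grafts, each of which trades one leaf for k + 1. *)
Fixpoint tree_seq n : seq (seq ptree) :=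
  if n is m.+1 then
    [seq rgraft k F l m.+1 | F <- tree_seq m, l <- iota 1 (t + m * k)]
  else [:: nseq t Leaf].

Lemma iota1S n : iota 1 n.+1 = rcons (iota 1 n) n.+1.
Proof. by rewrite -[in LHS](addn1 n) iotaD add1n cats1. Qed.

Lemma trees_rleaves n F : trees n k t F -> rleaves F = (t + n * k)%N.
Proof.
(* With n and t replaced by the numbers of labels and of root edges, the equation passes to
   subforests. *)
move=> [/perm_size + + <- _]; rewrite size_iota => <-.
elim/forest_ind: F => // [F IH|j F1 F2 IH1 IH2].
  by rewrite rleaves_Leaf /= => /IH ->.
rewrite rleaves_Node rlabels_Node /= size_cat.
move=> /andP[/andP[/eqP F1k /IH1 ->] /IH2 ->]; rewrite F1k mulSn mulnDl.
by clear; move: (_ * k)%N (_ * k)%N (size F2) => a b c; lia.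
Qed.

Lemma trees_size_rlabels n F : trees n k t F -> size (rlabels F) = n.
Proof. by case=> /perm_size; rewrite size_iota. Qed.

Lemma trees_rgraft n F l : trees n k t F -> (1 <= l <= t + n * k)%N ->
  trees n.+1 k t (rgraft k F l n.+1).
Proof.
move=> TF lF; have := TF; case=> pF aF sF iF.
split.
- have := @perm_rlabels_rgraft k F l n.+1.
  rewrite (trees_rleaves TF) => /(_ lF) /perm_trans; apply.
  by rewrite iota1S perm_sym perm_rcons perm_cons perm_sym.
- exact: arity_rgraft.
- by rewrite size_rgraft.
apply: increasing_rgraft => //.
by rewrite (perm_all _ pF); apply/allP => j; rewrite mem_iota; lia.
Qed.

Lemma trees_notin n F : trees n k t F -> n.+1 \notin rlabels F.
Proof. by case=> pF _ _ _; rewrite (perm_mem pF) mem_iota; lia. Qed.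

Lemma trees_prune n F : trees n.+1 k t F ->
  exists F' l, [/\ trees n k t F', (1 <= l <= t + n * k)%N &
    F = rgraft k F' l n.+1].
Proof.
move=> [pF aF sF iF].
have [|||l lF e] := @rprune_rgraft k n.+1 F _ _ _ aF iF.
- by rewrite (perm_all _ pF); apply/allP => j; rewrite mem_iota; lia.
- by rewrite (perm_uniq pF) iota_uniq.
- by rewrite (perm_mem pF) mem_iota; lia.
have TF' : trees n k t (rprune n.+1 F).
  split; [|exact: rprune_arity|by rewrite size_map|exact: increasing_rprune].
  have := perm_rlabels_rgraft k n.+1 lF; rewrite e perm_sym => /perm_trans/(_ pF).
  by rewrite iota1S [X in is_true X -> _]perm_sym perm_rcons perm_cons perm_sym.
by exists (rprune n.+1 F), l; rewrite -(trees_rleaves TF') e.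
Qed.

Lemma mem_tree_seq n F : F \in tree_seq n <-> trees n k t F.
Proof.
elim: n F => [|n IH] F /=.
  rewrite inE; split=> [/eqP ->|[/perm_nilP/rlabels_eq0 e _ <- _]]; last by rewrite -e.
  by split; rewrite ?rlabels_nseq ?size_nseq ?all_nseq ?orbT.
split=> [/allpairsP[[F' l] /= [/IH TF']]|/trees_prune[F' [l [TF' lF' ->]]]].
  by rewrite mem_iota => lF' ->; apply: trees_rgraft => //; lia.
by apply/allpairsP; exists (F', l); split=> //=; [exact/IH|rewrite mem_iota; lia].
Qed.

(** Pruning n + 1 recovers the smaller tree; injectivity of grafting then recovers the position. *)
Lemma tree_seq_uniq n : uniq (tree_seq n).
Proof.
elim: n => //= n IH; apply: allpairs_uniq; rewrite ?iota_uniq // => -[F l] [F' l'].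
move=> /allpairsP[[F1 l1] /= [/mem_tree_seq TF + [eF el]]].
rewrite -eF -el in TF * => {F1 l1 eF el}.
rewrite mem_iota => lF.
move=> /allpairsP[[F1 l1] /= [/mem_tree_seq TF' + [eF el]]].
rewrite -eF -el in TF' * => {F1 l1 eF el}.
rewrite mem_iota => lF' e.
have FF' : F = F'.
  by rewrite -(rgraftK k l (trees_notin TF)) e rgraftK // trees_notin.
rewrite -FF' in e *; congr pair; apply: rgraft_inj e.
  by rewrite (trees_rleaves TF); lia.
by rewrite (trees_rleaves TF); lia.
Qed.

Lemma composes_trees ls F : composes k t ls F -> trees (size ls) k t F.
Proof.
elim=> [|{}ls l {}F _ TF lF]; first by apply/mem_tree_seq; rewrite inE.
by rewrite size_rcons; apply: trees_rgraft; rewrite // -(trees_rleaves TF).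
Qed.

(** Both sequences have as many entries as the tree has internal vertices. Pruning the largest label
    undoes the last graft of each, so the smaller trees agree; then so do the last positions, and
    induction gives the rest. *)
Lemma composes_unique ls ls' F :
  composes k t ls F -> composes k t ls' F -> ls = ls'.
Proof.
move=> H; elim: H ls' => [|{}ls l {}F cF IH lF] ls'.
  move=> /composes_trees[/perm_size]; rewrite rlabels_nseq size_iota.
  by move=> /esym/size0nil ->.
move=> /[dup] /composes_trees TG cG.
have TF := composes_trees cF.
have : size ls' = size (rcons ls l).
  rewrite -(trees_size_rlabels TG) (perm_size (perm_rlabels_rgraft _ _ lF)) /=.
  by rewrite (trees_size_rlabels TF) size_rcons.
(* The grafted tree is generalised to a variable so that the second derivation can be inverted. *)
rewrite size_rcons; move: cG {TG}; move eG : (rgraft _ _ _ _) => G cG.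
case: cG eG => [//|ls1 l1 F1 cF1 lF1].
rewrite size_rcons => + [] ss; rewrite ss => e.
have TF1 := composes_trees cF1.
have FF1 : F = F1.
  rewrite -(rgraftK k l (trees_notin TF)) e -ss rgraftK //.
  exact: trees_notin.
rewrite -FF1 in cF1 lF1 e; congr rcons; first exact: IH.
exact: rgraft_inj e.
Qed.

Lemma decompositionE ls F : composes k t ls F -> decomposition k t F = ls.
Proof.
by move=> cF; apply: xget_unique => // ls' cF'; exact: composes_unique cF' cF.
Qed.

Lemma trees_composes n F : trees n k t F ->
  composes k t (decomposition k t F) F.
Proof.
move=> TF; suff [ls cF] : exists ls, composes k t ls F.
  by rewrite (decompositionE cF).
elim: n F TF => [|n IH] F.
  by move=> /mem_tree_seq; rewrite inE => /eqP ->; exists [::]; constructor.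
move=> /trees_prune[F' [l [TF' lF' ->]]]; have [ls cF'] := IH _ TF'.
have <- : size ls = n.
  by rewrite -(trees_size_rlabels (composes_trees cF')) (trees_size_rlabels TF').
exists (rcons ls l); constructor=> //.
by rewrite (trees_rleaves TF').
Qed.

Lemma weight_rgraft n F l : trees n k t F -> (1 <= l <= t + n * k)%N ->
  weight k t (rgraft k F l n.+1) = weight k t F * 'X^(l.-1).
Proof.
move=> TF lF; have cF := trees_composes TF.
have sn : size (decomposition k t F) = n.
  by rewrite -(trees_size_rlabels (composes_trees cF)) (trees_size_rlabels TF).
rewrite /weight (@decompositionE (rcons (decomposition k t F) l)).
  by rewrite big_rcons /=.
by rewrite -sn; constructor=> //; rewrite (trees_rleaves TF).
Qed.

(** Every tree with n vertices offers the same positions for c_(n+1), and position l multiplies the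
    weight by X^(l-1), so the sum factors. *)
Lemma qcard_trees n : qcard (trees n k t) (weight k t) =
  \prod_(0 <= j < n) \sum_(0 <= l < t + j * k) 'X^l.
Proof.
have -> : trees n k t = [set` tree_seq n]%classic.
  by apply/seteqP; split=> F /mem_tree_seq.
rewrite /qcard -fsbig_seq ?tree_seq_uniq //.
elim: n => [|n IH].
  by rewrite big_seq1 big_geq // /weight (decompositionE (composes_nil k t)) big_nil.
rewrite big_nat_recr //= -IH big_allpairs_dep mulr_suml.
rewrite big_seq [RHS]big_seq; apply: eq_bigr => F /mem_tree_seq TF.
(* Positions count from 1, exponents from 0: the range is shifted by one. *)
rewrite mulr_sumr -[X in \sum_(X <= _ < _) _]/(0%N).
rewrite -{1}[1%N]addn0 iotaDl big_map /index_iota subn0 big_seq [RHS]big_seq.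
apply: eq_bigr => l; rewrite mem_iota => lF.
by rewrite (weight_rgraft TF) //; lia.
Qed.

End Enumeration.

(** * Euler's identities *)

Section Euler.
Local Open Scope classical_set_scope.
Local Open Scope ring_scope.
#[local] Set Implicit Arguments.
#[local] Unset Strict Implicit.
Context {R : realType} (p : R) (p_gt0 : 0 < p) (p_lt1 : p < 1).
Implicit Types (z y : R) (a : R^nat).

Definition qpoch z n : R := \prod_(0 <= j < n) (1 - p ^+ j * z).

(** Coefficients of S, that is, of 1 / (z; p)_oo. *)
Definition euler_coef n : R := (qpoch p n)^-1.

(** Coefficients of F, that is, of (z; p)_oo. *)
Definition qexp_coef n : R := (-1) ^+ n * p ^+ 'C(n, 2) / qpoch p n.

Definition psum a z : R := limn (series (fun n => a n * z ^+ n)).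

Lemma qpochS z n : qpoch z n.+1 = qpoch z n * (1 - p ^+ n * z).
Proof. by rewrite /qpoch big_nat_recr. Qed.

Lemma qpoch_gt0 z n : 0 <= z -> z < 1 -> 0 < qpoch z n.
Proof.
move=> z0 z1; apply: prodr_gt0 => j _; rewrite subr_gt0.
apply: le_lt_trans z1; rewrite ler_piMl //.
by rewrite exprn_ile1 // ltW.
Qed.

Lemma qpoch_neq0 n : qpoch p n != 0.
Proof. by rewrite gt_eqF // qpoch_gt0 // ltW. Qed.

Lemma onem_exp_neq0 n : 1 - p ^+ n.+1 != 0.
Proof. by rewrite subr_eq0 eq_sym lt_eqF // exprn_ilt1 // ltW. Qed.

Lemma euler_coef_gt0 n : 0 < euler_coef n.
Proof. by rewrite invr_gt0 qpoch_gt0 // ltW. Qed.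

Lemma euler_coef0 : euler_coef 0 = 1.
Proof. by rewrite /euler_coef /qpoch big_geq // invr1. Qed.

Lemma qexp_coef0 : qexp_coef 0 = 1.
Proof. by rewrite /qexp_coef /qpoch big_geq // invr1 !mulr1. Qed.

(** Compares coefficients of z^(n+1) in S z - S (p z) = z S z. *)
Lemma euler_coefS n : euler_coef n.+1 * (1 - p ^+ n.+1) = euler_coef n.
Proof.
rewrite /euler_coef qpochS -exprSr.
by field; rewrite qpoch_neq0 onem_exp_neq0.
Qed.

(** Compares coefficients of z^(n+1) in F z - F (p z) = - z F (p z). *)
Lemma qexp_coefS n :
  qexp_coef n.+1 * (1 - p ^+ n.+1) = - p ^+ n * qexp_coef n.
Proof.
rewrite /qexp_coef qpochS -exprSr binS bin1 exprD [(-1) ^+ n.+1]exprS.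
by field; rewrite qpoch_neq0 onem_exp_neq0.
Qed.

Lemma normr_qexp_coef n : `|qexp_coef n| <= euler_coef n.
Proof.
rewrite /qexp_coef !normrM normr_sign mul1r normrX !ger0_norm ?(ltW p_gt0) //.
  by rewrite ler_piMl ?exprn_ile1 // ltW // ?euler_coef_gt0.
exact/ltW/euler_coef_gt0.
Qed.

(** The functional equation of S holds exactly for partial sums, one of them a term shorter. It is
    thus available before convergence is known, and serves to prove it. *)
Lemma euler_series_scale z n :
  series (fun i => euler_coef i * z ^+ i) n.+1 =
  series (fun i => euler_coef i * (p * z) ^+ i) n.+1 +
  z * series (fun i => euler_coef i * z ^+ i) n.
Proof.
rewrite /series /= mulr_sumr big_nat_recl // big_nat_recl // !expr0 -addrA.
congr (_ + _).
rewrite -big_split /=; apply: eq_bigr => i _.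
by rewrite -(euler_coefS i) !exprMn !exprS; ring.
Qed.

Lemma qexp_series_scale z n :
  series (fun i => qexp_coef i * z ^+ i) n.+1 =
  series (fun i => qexp_coef i * (p * z) ^+ i) n.+1 -
  z * series (fun i => qexp_coef i * (p * z) ^+ i) n.
Proof.
rewrite /series /= -mulNr mulr_sumr big_nat_recl // big_nat_recl // !expr0 -addrA.
congr (_ + _).
rewrite -big_split /=; apply: eq_bigr => i _.
rewrite !exprMn !exprS.
transitivity (qexp_coef i.+1 * (1 - p ^+ i.+1) * (z * z ^+ i) +
  qexp_coef i.+1 * (p * p ^+ i * (z * z ^+ i))); first by rewrite exprS; ring.
by rewrite qexp_coefS; ring.
Qed.

(** * Convergence of the two series *)

Lemma euler_term_ge0 z n : 0 <= z -> 0 <= euler_coef n * z ^+ n.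
Proof. by move=> z0; rewrite mulr_ge0 ?exprn_ge0 // ltW // euler_coef_gt0. Qed.

(** For the partial sums s_n, (1 - z) s_n(z) <= s_(n+1)(z) - z s_n(z) = s_(n+1)(p z), which is
    bounded by the limit at p z. *)
Lemma is_cvg_euler_scale z : 0 <= z -> z < 1 ->
  cvgn (series (fun n => euler_coef n * (p * z) ^+ n)) ->
  cvgn (series (fun n => euler_coef n * z ^+ n)).
Proof.
move=> z0 z1 cpz; apply: nondecreasing_is_cvgn.
  by apply: nondecreasing_series => n _ _; apply: euler_term_ge0.
exists (limn (series (fun n => euler_coef n * (p * z) ^+ n)) / (1 - z)) => _ [n _ <-].
have nd y : 0 <= y -> nondecreasing_seq (series (fun n => euler_coef n * y ^+ n)).
  by move=> y0; apply: nondecreasing_series => m _ _; apply: euler_term_ge0.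
rewrite ler_pdivlMr ?subr_gt0 //.
apply: (@le_trans _ _ (series (fun n => euler_coef n * (p * z) ^+ n) n.+1)).
  rewrite mulrBr mulr1 lerBlDr [X in _ + X]mulrC -euler_series_scale.
  exact: nd.
apply: nondecreasing_cvgn_le => //; apply: nd.
by rewrite mulr_ge0 // ltW.
Qed.

(** Since (p; p)_n >= (1 - p)^n, a geometric series of ratio z / (1 - p) dominates when z < 1 - p.
    Any other z is reached from some p^M z < 1 - p by M scaling steps. *)
Lemma is_cvg_euler z : 0 <= z -> z < 1 ->
  cvgn (series (fun n => euler_coef n * z ^+ n)).
Proof.
move=> z0 z1.
have [M] : exists M, p ^+ M * z < 1 - p.
  have : (GRing.exp p : R^nat) @ \oo --> 0 by apply: cvg_expr; rewrite gtr0_norm.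
  move=> /cvgrPdist_lt/(_ (1 - p)); rewrite subr_gt0 => /(_ p_lt1)[M _ H].
  exists M; have := H M (leqnn M); rewrite /= sub0r normrN gtr0_norm ?exprn_gt0 //.
  apply: le_lt_trans; rewrite ler_piMr ?exprn_ge0 // ltW //.
elim: M z z0 z1 => [|M IH] z z0 z1 zM.
  rewrite expr0 mul1r in zM.
  apply: (@series_le_cvg _ _ (geometric 1 (z / (1 - p)))).
  - by move=> n; apply: euler_term_ge0.
  - by move=> n; apply: geometric_ge0; rewrite // divr_ge0 // subr_ge0 ltW.
  - move=> n; rewrite /= mul1r expr_div_n mulrC ler_wpM2l ?exprn_ge0 //.
    rewrite lef_pV2 ?posrE ?exprn_gt0 ?subr_gt0 //; last by rewrite qpoch_gt0 // ltW.
    have -> : (1 - p) ^+ n = \prod_(0 <= j < n) (1 - p).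
      by rewrite prodr_const_nat subn0.
    rewrite /qpoch; apply: ler_prod => j _; rewrite subr_ge0 ltW //= lerD2l lerN2.
    by rewrite ler_piMl ?exprn_ile1 // ltW.
  apply: is_cvg_geometric_series.
  rewrite ger0_norm ?divr_ge0 ?subr_ge0 ?(ltW p_lt1) //.
  by rewrite ltr_pdivrMr ?mul1r // subr_gt0.
apply: is_cvg_euler_scale => //; apply: IH.
- by rewrite mulr_ge0 // ltW.
- by apply: le_lt_trans z1; rewrite ler_piMl // ltW.
- by rewrite mulrA -exprSr.
Qed.

Lemma is_cvg_dominated a z : (forall n, `|a n| <= euler_coef n) ->
  0 <= z -> z < 1 -> cvgn (series (fun n => a n * z ^+ n)).
Proof.
move=> ale z0 z1; apply: normed_cvg.
apply: (@series_le_cvg _ _ (fun n => euler_coef n * z ^+ n)).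
- by move=> n; rewrite normr_ge0.
- by move=> n; apply: euler_term_ge0.
- by move=> n; rewrite /= normrM (ger0_norm (exprn_ge0 _ z0)) ler_wpM2r ?exprn_ge0.
exact: is_cvg_euler.
Qed.

(** Each nonconstant term at p^n z is, in absolute value, at most p^n times the corresponding term
    of S z, so the distance to the constant coefficient is at most p^n S z. *)
Lemma psum_expz_cvg a z : (forall n, `|a n| <= euler_coef n) ->
  0 <= z -> z < 1 -> psum a (p ^+ n * z) @[n --> \oo] --> a 0.
Proof.
move=> ale z0 z1; pose C := psum euler_coef z.
have pn n : 0 <= p ^+ n * z by rewrite mulr_ge0 ?exprn_ge0 // ltW.
have pn1 n : p ^+ n * z < 1.
  by apply: le_lt_trans z1; rewrite ler_piMl ?exprn_ile1 // ltW.
have bnd n : `|psum a (p ^+ n * z) - a 0| <= C * p ^+ n.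
  have ca := @is_cvg_dominated _ _ ale (pn n) (pn1 n).
  have cd : (series (fun i => a i * (p ^+ n * z) ^+ i) m.+1 - a 0) @[m --> \oo]
      --> psum a (p ^+ n * z) - a 0.
    by apply: cvgB; [rewrite cvg_shiftS|exact: cvg_cst].
  apply: (cvgr_to_le (cvg_norm cd)); near=> m.
  rewrite /series /= big_nat_recl // expr0 mulr1 addrC addKr.
  apply: (le_trans (ler_norm_sum _ _ _)).
  apply: (@le_trans _ _ (series (fun i => euler_coef i * z ^+ i) m.+1 * p ^+ n)).
    rewrite mulr_suml big_nat_recl //= -[X in X <= _]add0r lerD //.
      by rewrite mulr_ge0 ?exprn_ge0 ?(ltW p_gt0) ?euler_term_ge0.
    apply: ler_sum => i _; rewrite normrM (ger0_norm (exprn_ge0 _ (pn n))) -mulrA.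
    apply: ler_pM; rewrite ?exprn_ge0 // exprMn mulrC ler_wpM2l ?exprn_ge0 //.
    by rewrite exprS ler_piMr ?exprn_ge0 ?(ltW p_gt0) ?exprn_ile1 ?exprn_ge0 // ltW.
  rewrite ler_wpM2r ?exprn_ge0 ?(ltW p_gt0) //.
  apply: nondecreasing_cvgn_le; last exact: is_cvg_euler.
  by apply: nondecreasing_series => i _ _; apply: euler_term_ge0.
apply/subr_cvg0/norm_cvg0P.
apply: (@squeeze_cvgr _ _ _ _ (cst 0) (fun n => C * p ^+ n)).
- by near=> n; rewrite normr_ge0 /=.
- exact: cvg_cst.
rewrite -(mulr0 C); apply: cvgMl_tmp.
by apply: cvg_expr; rewrite gtr0_norm.
Unshelve. all: by end_near. Qed.

(** * Functional equations and infinite products *)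

Lemma euler_psum_scale z : 0 <= z -> z < 1 ->
  (1 - z) * psum euler_coef z = psum euler_coef (p * z).
Proof.
move=> z0 z1.
have pz0 : 0 <= p * z by rewrite mulr_ge0 // ltW.
have pz1 : p * z < 1 by apply: le_lt_trans z1; rewrite ler_piMl // ltW.
have c1 := is_cvg_euler z0 z1; have c2 := is_cvg_euler pz0 pz1.
have : (series (fun n => euler_coef n * z ^+ n) n.+1) @[n --> \oo] -->
    psum euler_coef (p * z) + z * psum euler_coef z.
  under eq_fun do rewrite euler_series_scale.
  by apply: cvgD; [rewrite cvg_shiftS|apply: cvgMl_tmp].
rewrite cvg_shiftS => /(cvg_unique _ c1) e.
by rewrite mulrBl mul1r; apply/eqP; rewrite subr_eq; apply/eqP; exact: e.
Qed.

Lemma qexp_psum_scale z : 0 <= z -> z < 1 ->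
  psum qexp_coef z = (1 - z) * psum qexp_coef (p * z).
Proof.
move=> z0 z1.
have pz0 : 0 <= p * z by rewrite mulr_ge0 // ltW.
have pz1 : p * z < 1 by apply: le_lt_trans z1; rewrite ler_piMl // ltW.
have c1 := @is_cvg_dominated _ _ normr_qexp_coef z0 z1.
have c2 := @is_cvg_dominated _ _ normr_qexp_coef pz0 pz1.
have : (series (fun n => qexp_coef n * z ^+ n) n.+1) @[n --> \oo] -->
    psum qexp_coef (p * z) - z * psum qexp_coef (p * z).
  under eq_fun do rewrite qexp_series_scale.
  by apply: cvgB; [rewrite cvg_shiftS|apply: cvgMl_tmp].
rewrite cvg_shiftS => /(cvg_unique _ c1) e.
by rewrite mulrBl mul1r; exact: e.
Qed.

Lemma qpoch_psum z n : 0 <= z -> z < 1 ->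
  qpoch z n * psum euler_coef z = psum euler_coef (p ^+ n * z).
Proof.
move=> z0 z1; elim: n => [|n IH]; first by rewrite /qpoch big_geq // !mul1r.
rewrite qpochS mulrAC IH mulrC euler_psum_scale ?mulrA -?exprS //.
  by rewrite mulr_ge0 ?exprn_ge0 // ltW.
by apply: le_lt_trans z1; rewrite ler_piMl ?exprn_ile1 // ltW.
Qed.

Lemma qpoch_qexp_psum z n : 0 <= z -> z < 1 ->
  psum qexp_coef z = qpoch z n * psum qexp_coef (p ^+ n * z).
Proof.
move=> z0 z1; elim: n => [|n IH]; first by rewrite /qpoch big_geq // !mul1r.
rewrite qpochS IH -mulrA (@qexp_psum_scale (p ^+ n * z)) ?mulrA -?exprS //.
  by rewrite mulr_ge0 ?exprn_ge0 // ltW.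
by apply: le_lt_trans z1; rewrite ler_piMl ?exprn_ile1 // ltW.
Qed.

Lemma euler_psum_gt0 z : 0 <= z -> z < 1 -> 0 < psum euler_coef z.
Proof.
move=> z0 z1; apply: (@lt_le_trans _ _ 1) => //.
have -> : 1 = series (fun n => euler_coef n * z ^+ n) 1%N.
  by rewrite /series /= big_nat1 expr0 euler_coef0 mulr1.
apply: nondecreasing_cvgn_le; last exact: is_cvg_euler.
by apply: nondecreasing_series => i _ _; apply: euler_term_ge0.
Qed.

(** (z; p)_n = S (p^n z) / S z, and the numerator tends to the constant coefficient 1. *)
Lemma qpoch_cvg z : 0 <= z -> z < 1 ->
  qpoch z n @[n --> \oo] --> (psum euler_coef z)^-1.
Proof.
move=> z0 z1.
have -> : qpoch z = (fun n => psum euler_coef (p ^+ n * z) * (psum euler_coef z)^-1).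
  by apply/funext => n; rewrite -qpoch_psum // mulfK // gt_eqF // euler_psum_gt0.
rewrite -[X in _ --> X]mul1r -euler_coef0; apply: cvgMr_tmp.
apply: psum_expz_cvg => // n.
by rewrite ger0_norm // ltW // euler_coef_gt0.
Qed.

(* Both sides are the infinite product of the [1 - p ^+ j * z]. *)
Lemma qexp_psumE z : 0 <= z -> z < 1 ->
  psum qexp_coef z = (psum euler_coef z)^-1.
Proof.
move=> z0 z1.
have h : qpoch z n * psum qexp_coef (p ^+ n * z) @[n --> \oo] -->
    (psum euler_coef z)^-1 * qexp_coef 0.
  apply: cvgM; first exact: qpoch_cvg.
  exact: psum_expz_cvg normr_qexp_coef z0 z1.
rewrite qexp_coef0 mulr1 in h.
have e : (fun n => qpoch z n * psum qexp_coef (p ^+ n * z)) =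
    cst (psum qexp_coef z).
  by apply/funext => n; rewrite -qpoch_qexp_psum.
rewrite e in h; exact: cvg_unique (cvg_cst _) h.
Qed.

End Euler.

(** * The gamma function and the Jackson integral *)

Section GammaJackson.
Local Open Scope classical_set_scope.
Local Open Scope ring_scope.
#[local] Set Implicit Arguments.
#[local] Unset Strict Implicit.
Context {R : realType} (q : R) (k : nat).
Hypotheses (q_gt0 : 0 < q) (q_lt1 : q < 1) (k_gt0 : (0 < k)%N).

Let p := q ^+ k.
Let S := psum (euler_coef p).
(** [b] and [E] repeat the local definitions in the theorem, so that the results below apply to it
    directly. *)
Let b : R := qbracket q k%:R `^ (k%:R^-1) / (1 - q ^+ k) `^ (k%:R^-1).
Let E (x : R) : R := qexp (q ^+ k) (- (q ^+ k * x ^+ k / qbracket q k%:R)).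

Lemma exp_lt1 s : (0 < s)%N -> q ^+ s < 1.
Proof. by case: s => // s _; rewrite exprn_ilt1 // ltW. Qed.

Lemma exp_ge0 s : 0 <= q ^+ s.
Proof. by rewrite exprn_ge0 // ltW. Qed.

Let p_gt0 : 0 < p.
Proof. by rewrite exprn_gt0. Qed.

Let p_lt1 : p < 1.
Proof. exact: exp_lt1. Qed.

Let q1_gt0 : 0 < 1 - q.
Proof. by rewrite subr_gt0. Qed.

Let S_gt0 s : (0 < s)%N -> 0 < S (q ^+ s).
Proof. by move=> s0; apply: euler_psum_gt0; rewrite ?exp_ge0 ?exp_lt1. Qed.

Lemma qbracket_nat s : qbracket q s%:R = (1 - q ^+ s) / (1 - q).
Proof. by rewrite /qbracket powR_mulrn // ltW. Qed.

Lemma qbracket_sum s : qbracket q s%:R = \sum_(0 <= l < s) q ^+ l.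
Proof.
rewrite qbracket_nat big_mkord; apply: (canLR (mulfK _)); first by rewrite gt_eqF.
by rewrite -opprB subrX1 -mulNr opprB mulrC.
Qed.

Lemma evalN_trees t n :
  evalN (qcard (trees n k t) (weight k t)) q = qpochhammer q t%:R n k.
Proof.
rewrite qcard_trees /evalN.
(* Eta-contracting the coefficient map lets its ring morphism structure be found. *)
rewrite -[X in map_poly X _]/(GRing.natmul (1 : R)) rmorph_prod horner_prod.
apply: eq_bigr => j _; rewrite -natrD qbracket_sum rmorph_sum horner_sum.
by apply: eq_bigr => l _; rewrite /= map_polyXn hornerXn.
Qed.

Lemma qprod_infty_exp s : (0 < s)%N ->
  qprod_infty q k (- q ^+ s) = (S (q ^+ s))^-1.
Proof.
move=> s0; apply: cvg_lim => //.
have -> : (fun n => \prod_(0 <= j < n) (1 + q ^+ (j * k) * - q ^+ s)) =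
    qpoch p (q ^+ s).
  by apply/funext => n; apply: eq_bigr => j _; rewrite mulrN mulnC exprM.
by apply: qpoch_cvg; rewrite ?exp_ge0 ?exp_lt1.
Qed.

Let kR_neq0 : k%:R != 0 :> R.
Proof. by rewrite pnatr_eq0 -lt0n. Qed.

Lemma qkGamma_nat s : (0 < s)%N ->
  qkGamma q k s%:R = (1 - q) `^ (1 - s%:R / k%:R) * (S (q ^+ s) / S p).
Proof.
move=> s0; rewrite /qkGamma /qprod_pow.
(* The exponent is s - k, so the product in the denominator has argument -q^s and Euler's identity
   applies to both products. *)
have -> : q `^ (k%:R * (s%:R / k%:R - 1)) * - q ^+ k = - q ^+ s.
  have -> : k%:R * (s%:R / k%:R - 1) = s%:R - k%:R :> R by field.
  rewrite mulrN -!powR_mulrn ?(ltW q_gt0) // -powRD ?subrK //.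
  by rewrite (gt_eqF q_gt0) implybT.
rewrite !qprod_infty_exp // invrK mulrC -powRN opprB.
by congr (_ * _); rewrite mulrC.
Qed.

Lemma qkGamma_neq0 s : (0 < s)%N -> qkGamma q k s%:R != 0.
Proof.
move=> s0; rewrite qkGamma_nat // mulf_neq0 //.
  by rewrite gt_eqF // powR_gt0.
by rewrite mulf_neq0 ?invr_eq0 // gt_eqF // S_gt0.
Qed.

(** As q^(s + nk) = p^n q^s, the values of S differ by the factor (q^s; p)_n. The powers of 1 - q
    differ by (1 - q)^(-n), which supplies the denominators of the n brackets. *)
Lemma qkGamma_ratio s n : (0 < s)%N ->
  qpochhammer q s%:R n k = qkGamma q k (s%:R + (n * k)%:R) / qkGamma q k s%:R.
Proof.
move=> s0; apply: (canRL (mulfK (qkGamma_neq0 s0))).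
rewrite -natrD !qkGamma_nat ?addn_gt0 ?s0 //.
have -> : S (q ^+ (s + n * k)) = qpoch p (q ^+ s) n * S (q ^+ s).
  by rewrite (qpoch_psum p_gt0) ?exp_ge0 ?exp_lt1 // exprD mulnC exprM mulrC.
have -> : (1 - q) `^ (1 - (s + n * k)%:R / k%:R) =
    (1 - q) `^ (1 - s%:R / k%:R) * (1 - q) ^- n.
  rewrite -powR_mulrn ?(ltW q1_gt0) // -powRN -powRD; last first.
    by rewrite (gt_eqF q1_gt0) implybT.
  by congr (_ `^ _); rewrite natrD natrM; field.
have -> : qpochhammer q s%:R n k = qpoch p (q ^+ s) n * (1 - q) ^- n.
  have -> : (1 - q) ^- n = \prod_(0 <= j < n) (1 - q)^-1.
    by rewrite prodr_const_nat subn0 exprVn.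
  rewrite /qpochhammer /qpoch -big_split; apply: eq_bigr => j _.
  rewrite -natrD qbracket_nat /=.
  by rewrite exprD mulnC exprM mulrC [q ^+ s * _]mulrC mulrC.
by ring.
Qed.

(** [k]_q / (1 - q^k) = 1 / (1 - q), so b^k = 1 / (1 - q). *)
Let bE : b = (1 - q) `^ (- k%:R^-1).
Proof.
have p1 : 0 < 1 - p by rewrite subr_gt0.
rewrite /b qbracket_nat powRM ?invr_ge0 ?ltW // mulrAC mulfV ?mul1r; last first.
  by rewrite gt_eqF // powR_gt0.
by rewrite -powR_inv1 ?ltW // -powRrM mulN1r.
Qed.

Let b_expE s : b ^+ s = (1 - q) `^ (- (s%:R / k%:R)).
Proof. by rewrite bE -powR_mulrn ?powR_ge0 // -powRrM mulNr mulrC. Qed.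

(** The powers of 1 - p in [n]_p! absorb the rescaling of the argument, which turns E_p into F. *)
Lemma qexpE z : qexp p (- (z / (1 - p))) = psum (qexp_coef p) z.
Proof.
have p1 : 1 - p != 0 by rewrite subr_eq0 eq_sym lt_eqF.
congr (limn _); apply/funext => n; apply: eq_bigr => i _.
have -> : qfact p i = qpoch p p i / (1 - p) ^+ i.
  have -> : (1 - p) ^- i = \prod_(0 <= j < i) (1 - p)^-1.
    by rewrite prodr_const_nat subn0 exprVn.
  rewrite /qfact /qpoch -big_split big_add1; apply: eq_bigr => j _.
  by rewrite /qbracket powR_mulrn ?(ltW p_gt0) // exprSr.
rewrite /qexp_coef bin2 -divn2 [(- (z / _)) ^+ _]exprNn expr_div_n invf_div.
have qp := @qpoch_neq0 _ p p_gt0 p_lt1 i.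
by field; rewrite qp expf_neq0.
Qed.

(** At x = q^m b the kernel is F (p^(m+1)) = 1 / S (p^(m+1)), and S (p^(m+1)) = (p; p)_m S p. *)
Let E_geometric m : E (q ^+ m * b) = (S p)^-1 * euler_coef p m.
Proof.
have p1 : 1 - p != 0 by rewrite subr_eq0 eq_sym lt_eqF.
have q1 : 1 - q != 0 by rewrite gt_eqF.
have -> : E (q ^+ m * b) = qexp p (- (p ^+ m * p / (1 - p))).
  rewrite /E exprMn b_expE divff // powR_inv1 ?ltW // qbracket_nat.
  congr (qexp _ (- _)); rewrite -/p -exprM mulnC exprM -/p.
  by field; rewrite p1.
have pm0 : 0 <= p ^+ m * p by rewrite mulr_ge0 ?exprn_ge0 // ltW.
have pm1 : p ^+ m * p < 1 by rewrite -exprSr exprn_ilt1 // ltW.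
rewrite qexpE qexp_psumE // -(qpoch_psum p_gt0) ?ltW //.
by rewrite invfM mulrC.
Qed.

(** The m-th term is b^(s-1) / S p times (q^s)^m / (p; p)_m, so the terms sum to a multiple of S
    (q^s). *)
Lemma jackson_qkGamma s : (0 < s)%N ->
  jackson q b (fun x => x ^+ (s - 1) * E x) = qkGamma q k s%:R.
Proof.
case: s => // s _; rewrite subn1 /= /jackson.
have -> : \big[+%R/0]_(0 <= n <oo)
    (q ^+ n * ((q ^+ n * b) ^+ s * E (q ^+ n * b))) =
    b ^+ s / S p * S (q ^+ s.+1).
  apply: cvg_lim => //.
  have -> : (fun n => \sum_(0 <= i < n)
      (q ^+ i * ((q ^+ i * b) ^+ s * E (q ^+ i * b)))) =
    (fun n => b ^+ s / S p *
      series (fun i => euler_coef p i * (q ^+ s.+1) ^+ i) n).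
    apply/funext => n; rewrite /series /= mulr_sumr; apply: eq_bigr => i _.
    by rewrite E_geometric exprMn -!exprM mulSn exprD mulnC; ring.
  apply: cvgMl_tmp.
  by apply: (is_cvg_euler p_gt0 p_lt1); rewrite ?exp_ge0 ?exp_lt1.
rewrite qkGamma_nat //.
(* The prefactor (1 - q) b of the integral completes b^s to the power of 1 - q in the gamma
   function. *)
have -> : (1 - q) `^ (1 - s.+1%:R / k%:R) = (1 - q) * b ^+ s.+1.
  rewrite b_expE powRD; last by rewrite (gt_eqF q1_gt0) implybT.
  by rewrite powRr1 // ltW.
by rewrite [b ^+ s.+1]exprS; ring.
Qed.

End GammaJackson.

Theorem theorem8 (R : realType) (q : R) (k t n : nat)
    (q_gt0 : 0 < q) (q_lt1 : q < 1) (k_ge1 : (1 <= k)%N) (t_ge1 : (1 <= t)%N) :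
  let b : R := qbracket q k%:R `^ (k%:R^-1) / (1 - q ^+ k) `^ (k%:R^-1) in
  let E (x : R) : R :=
    qexp (q ^+ k) (- (q ^+ k * x ^+ k / qbracket q k%:R)) in
  [/\ evalN (qcard (trees n k 1) (weight k 1)) q = qpochhammer q 1 n k,
      qpochhammer q 1 n k = qkGamma q k (1 + (n * k)%:R) / qkGamma q k 1 &
      qkGamma q k (1 + (n * k)%:R) / qkGamma q k 1 =
        1 / qkGamma q k 1 * jackson q b (fun x => x ^+ (n * k) * E x)]
  /\
  [/\ evalN (qcard (trees n k t) (weight k t)) q = qpochhammer q t%:R n k,
      qpochhammer q t%:R n k =
        qkGamma q k (t%:R + (n * k)%:R) / qkGamma q k t%:R &
      qkGamma q k (t%:R + (n * k)%:R) / qkGamma q k t%:R =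
        1 / qkGamma q k t%:R *
          jackson q b (fun x => x ^+ (t + n * k - 1) * E x)].
Proof.
move=> b E.
have main s : (0 < s)%N ->
  [/\ evalN (qcard (trees n k s) (weight k s)) q = qpochhammer q s%:R n k,
      qpochhammer q s%:R n k =
        qkGamma q k (s%:R + (n * k)%:R) / qkGamma q k s%:R &
      qkGamma q k (s%:R + (n * k)%:R) / qkGamma q k s%:R =
        1 / qkGamma q k s%:R *
          jackson q b (fun x => x ^+ (s + n * k - 1) * E x)].
  move=> s0; split; first exact: evalN_trees.
    exact: qkGamma_ratio.
  by rewrite jackson_qkGamma ?addn_gt0 ?s0 // natrD mul1r mulrC.
split; last exact: main.
(* The first chain is the case s = 1, where the exponent 1 + nk - 1 reduces to nk. *)
by have := main 1%N isT; rewrite addKn.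
Qed.
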